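(* Let $X, Y$ be non-zero ordered normed spaces with the following properties: (1) The cone $X_+$ is total, there exists an equivalent norm on $X$ that is additive on $X_+$, and every extremal vector of $X_+$ is also extremal in the bidual cone $X''_+$ (where $X$ is identified with its canonical image in $X''$). Moreover, the convex hull of the extremal vectors in $X_+$ is dense in $X_+$. (2) The cone $Y_+$ has non-empty interior. Then the space $\mathcal{C}(X,Y)$ is an anti-lattice if and only if both $X'$ and $Y$ are anti-lattices.
   Context: All vector spaces are real. A wedge in a real vector space $V$ is a non-empty subset $V_+$ with $\alpha V_+ + \beta V_+ \subseteq V_+$ for all real $\alpha,\beta \ge 0$; it is a cone if in addition $V_+ \cap (-V_+) = \{0\}$. One writes $x \le y$ if $y - x \in V_+$, and $[v_1,v_2] = \{x \in V : v_1 \le x \le v_2\}$. A vector $v \in V_+$ is called extremal in $V_+$ (an extremal vector of $V_+$) if all elements of $[0,v]$ are scalar multiples of $v$. An ordered normed space is a normed space $X$ (not necessarily complete) endowed with a norm closed cone $X_+$. The cone $X_+$ is total if its linear span is norm dense in $X$. A norm on $X$ is additive on $X_+$ if $\|x_1+x_2\| = \|x_1\|+\|x_2\|$ for all $x_1,x_2\in X_+$. The norm dual $X'$ is endowed with the dual wedge $X'_+ = \{x' \in X' : \langle x', x\rangle \ge 0 \text{ for all } x \in X_+\}$; the bidual $X''$ is endowed with $X''_+ = \{x'' \in X'' : \langle x'', x'\rangle \ge 0 \text{ for all } x' \in X'_+\}$. $\mathcal{L}(X,Y)$ is the space of bounded linear operators from $X$ to $Y$ with the operator norm, and $\mathcal{L}(X,Y)_+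 = \{T \in \mathcal{L}(X,Y): T[X_+] \subseteq Y_+\}$. $\mathcal{C}(X,Y)$ is the operator norm closure in $\mathcal{L}(X,Y)$ of the subspace of bounded finite rank operators, ordered by $\mathcal{C}(X,Y)_+ = \mathcal{C}(X,Y) \cap \mathcal{L}(X,Y)_+$. An Archimedean ordered vector space $Z$ with generating cone (i.e. $Z = Z_+ - Z_+$) is an anti-lattice if any two elements of $Z$ have an infimum in $Z$ if and only if they are comparable (one of them is larger than or equal to the other). Equivalently, two non-zero elements of $Z_+$ are never disjoint, where $z_1,z_2\in Z_+$ are disjoint if their infimum in $Z$ exists and equals $0$. *)

(* Defs.v *)
(* MathComp-Analysis, over an arbitrary R : realType. An ordered space is a
   vector space together with its positive cone, given as a set. *)
From HB Require Import structures.
From mathcomp Require Import all_boot all_order all_algebra.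
From mathcomp Require Import all_classical all_reals all_analysis.

Set Implicit Arguments.
Unset Strict Implicit.
Unset Printing Implicit Defensive.

Import Order.TTheory GRing.Theory Num.Theory.
Import numFieldNormedType.Exports.

Local Open Scope classical_set_scope.
Local Open Scope ring_scope.

Section OrderedVectorSpaces.
Context {R : realType} {V : lmodType R}.
Implicit Types (P A : set V) (x y z v : V).

Definition is_wedge P : Prop :=
  P !=set0 /\
  forall (a b : R) x y, 0 <= a -> 0 <= b -> P x -> P y -> P (a *: x + b *: y).

Definition is_cone P : Prop := is_wedge P /\ P `&` -%R @` P = [set 0].

Definition cone_le P x y : Prop := P (y - x).

Definition cone_itv P x y : set V := [set z | cone_le P x z /\ cone_le P z y].

(* The zero vector of a wedge is allowed as an extremal vector. *)
Definition extremal P v : Prop :=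
  P v /\ forall x, cone_itv P 0 v x -> exists c : R, x = c *: v.

Definition archimedean_cone P : Prop :=
  forall x y, (forall n : nat, (0 < n)%N -> cone_le P (n%:R *: x) y) ->
    cone_le P x 0.

Definition generating P : Prop :=
  forall z, exists x y, [/\ P x, P y & z = x - y].

Definition is_infimum P x y z : Prop :=
  [/\ cone_le P z x, cone_le P z y &
      forall w, cone_le P w x -> cone_le P w y -> cone_le P w z].

Definition comparable_in P x y : Prop := cone_le P x y \/ cone_le P y x.

(* Being an Archimedean ordered vector space with generating cone is part of
   being an anti-lattice. *)
Record anti_lattice P : Prop := AntiLattice {
  anti_lattice_cone : is_cone P;
  anti_lattice_archimedean : archimedean_cone P;
  anti_lattice_generating : generating P;
  anti_lattice_inf : forall x y,
    (exists z, is_infimum P x y z) <-> comparable_in P x y }.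

Definition linear_span A : set V :=
  [set x | exists (n : nat) (c : 'I_n -> R) (v : 'I_n -> V),
    (forall i, A (v i)) /\ x = \sum_(i < n) c i *: v i].

Definition convex_hull A : set V :=
  [set x | exists (n : nat) (c : 'I_n -> R) (v : 'I_n -> V),
    [/\ forall i, 0 <= c i, \sum_(i < n) c i = 1, forall i, A (v i)
      & x = \sum_(i < n) c i *: v i]].

End OrderedVectorSpaces.

Section OrderedNormedSpaces.
Context {R : realType} {X : normedModType R}.
Implicit Types (P : set X) (N : X -> R).

Definition ordered_normed_space P : Prop := is_cone P /\ closed P.

Definition total_cone P : Prop := dense (linear_span P).

Definition is_norm N : Prop :=
  [/\ forall x y, N (x + y) <= N x + N y,
      forall (a : R) x, N (a *: x) = `|a| * N x
    & forall x, N x = 0 -> x = 0].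

Definition equivalent_norm N : Prop :=
  is_norm N /\
  exists c C : R, [/\ 0 < c, 0 < C & forall x, c * `|x| <= N x <= C * `|x|].

Definition additive_on P N : Prop :=
  forall x y, P x -> P y -> N (x + y) = N x + N y.

End OrderedNormedSpaces.

Section BoundedOperators.
Context {R : realType} (X Y : normedModType R).

Definition bounded_operator (f : X -> Y) : Prop :=
  linear f /\ exists M : R, forall x, `|f x| <= M * `|x|.

Definition bounded_operator_pred : {pred X -> Y} :=
  [pred f | `[< bounded_operator f >]].

Lemma bounded_operator_submod : submod_closed bounded_operator_pred.
Proof.
split=> [|a f g].
  apply/asboolP; split=> [a x y|]; first by rewrite scaler0 addr0.
  by exists 0 => x; rewrite normr0 mul0r.
move=> /asboolP[lf [M fM]] /asboolP[lg [N gN]]; apply/asboolP; split.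
  move=> b x y; pose h z := a *: f z + g z.
  rewrite -[LHS]/(h (b *: x + y)) -[RHS]/(b *: h x + h y) /h lf lg.
  by rewrite !scalerDr !scalerA [a * b]mulrC addrACA.
exists (`|a| * M + N) => x.
rewrite -[(a *: f + g) x]/(a *: f x + g x) (le_trans (ler_normD _ _))//.
by rewrite mulrDl lerD// normrZ -mulrA ler_wpM2l.
Qed.

HB.instance Definition _ := GRing.isSubmodClosed.Build R (X -> Y)
  bounded_operator_pred bounded_operator_submod.

(* L(X, Y); the dual of X is bop X R^o and its bidual is
   bop (bop X R^o) R^o. *)
Record bop := BOp {
  bop_fun :> X -> Y;
  bop_in : bounded_operator_pred bop_fun }.

HB.instance Definition _ := [isSub for bop_fun].
HB.instance Definition _ := [Choice of bop by <:].
HB.instance Definition _ := [SubChoice_isSubLmodule of bop by <:].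

Lemma bopP (T : bop) : bounded_operator T.
Proof. exact: asboolW (bop_in T). Qed.

Fact bop_linear (T : bop) : linear T.
Proof. by case: (bopP T). Qed.

HB.instance Definition _ (T : bop) :=
  GRing.isLinear.Build R X Y *:%R (bop_fun T) (bop_linear T).

Definition op_norm (T : bop) : R := sup [set `|T x| | x in [set x | `|x| <= 1]].

Fact op_norm_has_sup (T : bop) :
  has_sup [set `|T x| | x in [set x | `|x| <= 1]].
Proof.
split; first by exists `|T 0|, 0 => //=; rewrite normr0.
have [_ [M TM]] := bopP T; exists `|M| => _ [x /= x1 <-].
rewrite (le_trans (TM x))// (@le_trans _ _ (`|M| * `|x|))//.
  by rewrite ler_wpM2r// ler_norm.
by rewrite ler_piMr.
Qed.

Fact op_norm_ball (T : bop) x : `|x| <= 1 -> `|T x| <= op_norm T.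
Proof. by move=> x1; apply: ub_le_sup; [case: (op_norm_has_sup T)|exists x]. Qed.

Fact op_norm_le (T : bop) (M : R) :
  (forall x, `|x| <= 1 -> `|T x| <= M) -> op_norm T <= M.
Proof.
move=> TM; apply: ge_sup; first by case: (op_norm_has_sup T).
by move=> _ [x /= x1 <-]; exact: TM.
Qed.

Fact op_normD (S T : bop) : op_norm (S + T) <= op_norm S + op_norm T.
Proof.
apply: op_norm_le => x x1; rewrite -[(S + T) x]/(S x + T x).
by rewrite (le_trans (ler_normD _ _))// lerD// op_norm_ball.
Qed.

Fact op_normZ (a : R) (T : bop) : op_norm (a *: T) = `|a| * op_norm T.
Proof.
have le b S : op_norm (b *: S) <= `|b| * op_norm S.
  apply: op_norm_le => x x1; rewrite -[(b *: S) x]/(b *: S x) normrZ.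
  by rewrite ler_wpM2l// op_norm_ball.
apply/eqP; rewrite eq_le le/=.
have [->|a0] := eqVneq a 0.
  by rewrite normr0 mul0r (le_trans (normr_ge0 ((0 *: T) 0)))// op_norm_ball// normr0.
rewrite -ler_pdivlMl ?normr_gt0// -normfV.
by rewrite -{1}[T](scalerK a0) le.
Qed.

Fact op_norm_eq0 (T : bop) : op_norm T = 0 -> T = 0.
Proof.
move=> T0; apply: val_inj; apply/funext => x /=; apply/eqP.
rewrite -normr_eq0 eq_le normr_ge0 andbT.
have [->|x0] := eqVneq x 0; first by rewrite linear0 normr0.
have /(op_norm_ball T) : `| `|x|^-1 *: x| <= 1.
  by rewrite normrZ normfV normr_id mulVf// normr_eq0.
by rewrite T0 linearZ normrZ normfV normr_id pmulr_rle0// invr_gt0 normr_gt0.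
Qed.

HB.instance Definition _ :=
  Lmodule_isNormed.Build R bop op_normD op_normZ op_norm_eq0.

Fact bop_norm_bound (T : bop) x : `|T x| <= `|T| * `|x|.
Proof.
have [->|x0] := eqVneq x 0; first by rewrite linear0 !normr0 mulr0.
rewrite -ler_pdivrMr ?normr_gt0// mulrC.
rewrite -[X in X * _](ger0_norm (_ : 0 <= `|x|^-1)) ?invr_ge0//.
rewrite -normrZ -linearZ op_norm_ball// normrZ normfV normr_id.
by rewrite mulVf// normr_eq0.
Qed.

End BoundedOperators.

Section LinearSpanTheory.
Context {R : realType} {V : lmodType R}.
Implicit Types (A B : set V) (x y : V).

Fact sub_linear_span A B : A `<=` B -> linear_span A `<=` linear_span B.
Proof.
by move=> AB x [n [c [v [Av ->]]]]; exists n, c, v; split=> // i; exact: AB.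
Qed.

Fact linear_span0 A : linear_span A 0.
Proof. by exists 0%N, (fun=> 0), (fun=> 0); split=> [[]//|]; rewrite big_ord0. Qed.

Fact linear_span_lin A (a : R) x y :
  linear_span A x -> linear_span A y -> linear_span A (a *: x + y).
Proof.
move=> [m [c [v [Av ->]]]] [n [d [w [Aw ->]]]].
exists (m + n)%N, (fun i => match fintype.split i with inl j => a * c j | inr k => d k end),
  (fun i => match fintype.split i with inl j => v j | inr k => w k end).
split=> [i|]; first by case: (fintype.split i).
rewrite big_split_ord/= scaler_sumr; congr (_ + _); apply: eq_bigr => i _.
  by rewrite (unsplitK (inl i)) scalerA.
by rewrite (unsplitK (inr i)).
Qed.

End LinearSpanTheory.

Section ApproximableOperators.
Context {R : realType} (X Y : normedModType R).

(* The range lies in the span of finitely many vectors. *)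
Definition finite_rank (T : bop X Y) : Prop :=
  exists s : seq Y, range T `<=` linear_span [set` s].

Definition approximable_pred : {pred bop X Y} :=
  [pred T | `[< closure [set S | finite_rank S] T >]].

Lemma approximable_submod : submod_closed approximable_pred.
Proof.
split=> [|a S T].
  apply/asboolP; apply: subset_closure; exists [::] => _ [x _ <-].
  exact: linear_span0.
move=> /asboolP clS /asboolP clT; apply/asboolP => B.
have : (fun z : bop X Y * bop X Y => a *: z.1 + z.2) @ (S, T)
    --> a *: S + T.
  by apply: cvgD; [apply: cvgZr; exact: cvg_fst|exact: cvg_snd].
move=> /[apply] -[[U W] /= [/clS[S' [[s sS'] US']] /clT[T' [[t tT'] WT']]] UWB].
exists (a *: S' + T'); split; last exact: (UWB (S', T')).
exists (s ++ t) => _ [x _ <-].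
rewrite -[(a *: S' + T') x]/(a *: S' x + T' x).
apply: linear_span_lin.
  apply: (@sub_linear_span _ _ [set` s]); last by apply: sS'; exists x.
  by move=> y /=; rewrite mem_cat => ->.
apply: (@sub_linear_span _ _ [set` t]); last by apply: tT'; exists x.
by move=> y /=; rewrite mem_cat => ->; rewrite orbT.
Qed.

HB.instance Definition _ := GRing.isSubmodClosed.Build R (bop X Y)
  approximable_pred approximable_submod.

(* C(X, Y): the closure, for the operator norm, of the finite rank operators. *)
Record approx_op := ApproxOp {
  approx_op_val :> bop X Y;
  approx_op_in : approximable_pred approx_op_val }.

HB.instance Definition _ := [isSub for approx_op_val].
HB.instance Definition _ := [Choice of approx_op by <:].
HB.instance Definition _ := [SubChoice_isSubLmodule of approx_op by <:].

End ApproximableOperators.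

Section OperatorCones.
Context {R : realType} (X Y : normedModType R) (P : set X) (Q : set Y).

Definition bop_cone : set (bop X Y) := [set T | forall x, P x -> Q (T x)].

Definition approx_op_cone : set (approx_op X Y) :=
  [set T | bop_cone (approx_op_val T)].

Definition dual_wedge : set (bop X R^o) :=
  [set f | forall x, P x -> 0 <= f x].

End OperatorCones.

Section Bidual.
Context {R : realType} (X : normedModType R).

Fact eval_bounded_operator (x : X) :
  bounded_operator_pred (fun f : bop X R^o => (f x : R^o)).
Proof.
apply/asboolP; split=> [//|].
by exists `|x| => f; rewrite mulrC bop_norm_bound.
Qed.

Definition canonical_embedding (x : X) : bop (bop X R^o) R^o :=
  BOp (eval_bounded_operator x).

End Bidual.

(* Main.v *)
Require Import Defs.
From HB Require Import structures.
From mathcomp Require Import all_boot all_order all_algebra.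
From mathcomp Require Import all_classical all_reals all_analysis.
From mathcomp Require Import lra ring.

Set Implicit Arguments.
Unset Strict Implicit.
Unset Printing Implicit Defensive.

Import Order.TTheory GRing.Theory Num.Theory.
Import numFieldNormedType.Exports.

Local Open Scope classical_set_scope.
Local Open Scope ring_scope.

(** Write f (x) y for the operator sending z to f z *: y.  Replacing two
    elements with an infimum by their differences with it, being an
    anti-lattice means that there are no two non-zero disjoint positive
    elements, where disjoint means that every common lower bound is <= 0
    (anti_lattice_disjoint, disjoint_anti_lattice).  Vectors and values <= 0
    are called negative.

    Order units drive everything.  The additive norm yields a functional e with
    |x| <= e x on the cone of X (additive_norm_functional), an interior point of
    the cone of Y yields u with |y| u - y >= 0 (interior_norm_unit), and then
    e (x) u is an order unit of C(X, Y).  In particular the cones are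
    generating and positive functionals are bounded by the operator norm.

    If C(X, Y) is an anti-lattice, so are X' and Y: disjoint f, h in X' give
    disjoint f (x) u, h (x) u, and disjoint y, z in Y give disjoint e (x) y,
    e (x) z, as one sees by composing a common lower bound with positive
    functionals on Y, respectively by evaluating it at points of X.

    Conversely let S and T be disjoint in C(X, Y).  The key point is that S x
    and T x are disjoint for every extremal x (disjoint_at_extremal).  Suppose
    z <= S x, T x but g z > 0 for some positive g in Y'.  Every common lower
    bound A of S and T is negative, hence g (A x) <= 0.  By Hahn-Banach duality
    (split_functional) the functional A |-> g (A x) splits into positive
    functionals F and F' with F S + F' T <= 0.  As x is extremal in the bidual
    cone, F(. (x) y) is a multiple of evaluation at x for each y >= 0, whence
    F A = d (A x) and F' A = (g - d) (A x) for a functional d with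
    0 <= d <= g (extremal_factor); so
    0 >= d (S x) + (g - d) (T x) >= d z + (g - d) z = g z, a contradiction.

    As Y is an anti-lattice, S x = 0 or T x = 0 for each extremal x.  For
    positive g in Y', a common lower bound of g o S and g o T is then negative
    at extremal vectors, hence on the whole cone by density; as X' is an
    anti-lattice, g o S = 0 or g o T = 0.  If S and T were both non-zero, some
    g would detect S, some h would detect T, and g + h would detect both. *)

(** * Sublinear functionals and the Hahn-Banach theorem *)

Section HahnBanach.
Context {R : realType} {V : lmodType R}.
Implicit Types (p q : V -> R) (x y z : V).

Definition sublinear p : Prop :=
  (forall x y, p (x + y) <= p x + p y) /\
  forall (a : R) x, 0 < a -> p (a *: x) <= a * p x.

Lemma sublinearZ p : sublinear p -> forall (a : R) x, 0 < a -> p (a *: x) = a * p x.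
Proof.
move=> [_ pZ] a x a0; apply/eqP; rewrite eq_le pZ//= -ler_pdivlMl//.
by rewrite -{1}[x](scalerK (negbT (gt_eqF a0))) pZ ?invr_gt0.
Qed.

Lemma sublinear0 p : sublinear p -> p 0 = 0.
Proof.
by move=> /sublinearZ/(_ 2 0 (ltr0n _ 2)); rewrite scaler0 => ?; lra.
Qed.

Lemma sublinearN p x : sublinear p -> - p (- x) <= p x.
Proof.
move=> sp; rewrite -subr_ge0 opprK -(sublinear0 sp) -(subrr x).
by case: sp.
Qed.

(** All sublinear functionals below are infima of sets F x of upper estimates:
    a family compatible with sums and positive scalings yields one as soon as
    F 0 has no negative element, since this already bounds each F x from below
    by the opposite of any element of F (- x). *)
Lemma inf_sublinear (F : V -> set R) :
  (forall x, F x !=set0) ->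
  (forall x y r s, F x r -> F y s -> F (x + y) (r + s)) ->
  (forall (a : R) x r, 0 < a -> F x r -> F (a *: x) (a * r)) ->
  (forall r, F 0 r -> 0 <= r) ->
  sublinear (inf \o F) /\ forall x r, F x r -> inf (F x) <= r.
Proof.
move=> F0 FD FZ Fge0.
have Flb x : has_lbound (F x).
  have [s Fs] := F0 (- x); exists (- s) => r Fr.
  rewrite -subr_ge0 opprK; apply: Fge0.
  by rewrite -(subrr x); exact: FD.
have Fle x r : F x r -> inf (F x) <= r by exact: ge_inf.
split=> //; split=> [x y|a x a0] /=.
  rewrite -lerBlDr; apply: lb_le_inf => // r Fr.
  rewrite lerBlDr -lerBlDl; apply: lb_le_inf => // s Fs.
  by rewrite lerBlDl; apply: Fle; exact: FD.
rewrite mulrC -ler_pdivrMr//; apply: lb_le_inf => // r Fr.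
by rewrite ler_pdivrMr// mulrC; apply: Fle; exact: FZ.
Qed.

(** Every sublinear p can be lowered so as to become linear along the line of
    x0 without changing at x0: take the infimum over t >= 0 of
    p (x + t x0) - t p x0. *)
Lemma sublinear_press p x0 : sublinear p ->
  exists q, [/\ sublinear q, forall x, q x <= p x & q (- x0) <= - p x0].
Proof.
move=> sp; have [pD pZ] := sp.
pose F x : set R := [set r | exists2 t : R, 0 <= t & p (x + t *: x0) - t * p x0 <= r].
have [] := @inf_sublinear F.
- by move=> x; exists (p (x + 0 *: x0) - 0 * p x0), 0.
- move=> x y r s [t t0 tr] [u u0 us]; exists (t + u); first exact: addr_ge0.
  rewrite scalerDl addrACA mulrDl.
  by have := pD (x + t *: x0) (y + u *: x0); lra.
- move=> a x r a0 [t t0 tr]; exists (a * t); first by rewrite mulr_ge0// ltW.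
  rewrite -scalerA -scalerDr (sublinearZ sp)// -mulrA -mulrBr.
  by rewrite ler_pM2l.
- move=> r [t]; rewrite add0r le_eqVlt => /predU1P[<-|t0].
    by rewrite scale0r (sublinear0 sp) mul0r subr0.
  by rewrite (sublinearZ sp)// subrr.
move=> sF Fle; exists (inf \o F); split=> //= [x|].
  by apply: Fle; exists 0; rewrite // scale0r addr0 mul0r subr0.
apply: Fle; exists 1; rewrite ?ler01// scale1r addNr (sublinear0 sp).
by rewrite mul1r add0r.
Qed.

(** Zorn's lemma: the pointwise infimum of a chain of sublinear functionals
    below p is again sublinear, and it is finite because each of them is bounded
    below at x by - p (- x). *)
Lemma minimal_sublinear p : sublinear p ->
  exists m, [/\ sublinear m, forall x, m x <= p x &
    forall q, sublinear q -> (forall x, q x <= m x) -> forall x, m x <= q x].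
Proof.
move=> sp; pose T := {q | sublinear q /\ forall x, q x <= p x}.
pose Rl (q1 q2 : T) := `[< forall x, sval q2 x <= sval q1 x >].
have [||| [m [sm mp]] mmin] := @ZL_preorder T (exist _ p (conj sp (fun=> lexx _))) Rl.
- by move=> q; apply/asboolP.
- move=> q1 q2 q3 /asboolP q12 /asboolP q23; apply/asboolP => x.
  exact: le_trans (q23 x) (q12 x).
- move=> A Atot; have [[q0 Aq0]|A0] := pselect (A !=set0); last first.
    exists (exist _ p (conj sp (fun=> lexx _))) => q Aq.
    by case: A0; exists q.
  pose F x : set R := [set r | exists2 q, A q & sval q x <= r].
  have [] := @inf_sublinear F.
  + by move=> x; exists (sval q0 x), q0.
  + move=> x y r s [q Aq qr] [q' Aq' qs].
    have [/asboolP qq|/asboolP qq] := Atot _ _ Aq Aq'.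
      exists q' => //; have := (svalP q').1.1 x y; have := qq x; lra.
    exists q => //; have := (svalP q).1.1 x y; have := qq y; lra.
  + move=> a x r a0 [q Aq qr]; exists q => //.
    by rewrite (sublinearZ (svalP q).1)// ler_pM2l.
  + by move=> r [q Aq]; rewrite (sublinear0 (svalP q).1).
  move=> sF Fle.
  have Fp x : (inf \o F) x <= p x.
    by apply: Fle; exists q0 => //; exact: (svalP q0).2.
  exists (exist _ (inf \o F) (conj sF Fp)) => q Aq; apply/asboolP => x /=.
  by apply: Fle; exists q.
exists m; split=> // q sq qm.
have qp x : q x <= p x by exact: le_trans (mp x).
by have /asboolP := mmin (exist _ q (conj sq qp)) (asboolT qm).
Qed.

(** Pressing a minimal m along any direction cannot lower it, hence m (- x) is
    - m x and subadditivity becomes additivity. *)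
Lemma minimal_sublinear_scalar m : sublinear m ->
  (forall q, sublinear q -> (forall x, q x <= m x) -> forall x, m x <= q x) ->
  scalar m.
Proof.
move=> sm mmin; have [mD mZ] := sm.
have mN x : m (- x) = - m x.
  have [q [sq qm qx]] := sublinear_press x sm.
  have := mmin q sq qm (- x); have := sublinearN x sm.
  by move=> ? ?; apply/eqP; rewrite eq_le; apply/andP; split; lra.
have madd x y : m (x + y) = m x + m y.
  have := mD x y; have := mD (x + y) (- y); rewrite addrK mN => ? ?.
  by apply/eqP; rewrite eq_le; apply/andP; split; lra.
move=> a x y; rewrite madd; congr (_ + _).
have [a0|a0|->] := ltgtP a 0; last by rewrite scale0r mul0r sublinear0.
  by rewrite -[a]opprK scaleNr mN mulNr sublinearZ// oppr_gt0.
by rewrite sublinearZ.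
Qed.

(** Pressing p along x0 before minimizing forces the linear minorant to attain
    p at the prescribed point. *)
Theorem hahn_banach p x0 : sublinear p ->
  exists f : {scalar V}, (forall x, f x <= p x) /\ f x0 = p x0.
Proof.
move=> sp; have [q [sq qp qx0]] := sublinear_press x0 sp.
have [m [sm mq mmin]] := minimal_sublinear sq.
have lm := minimal_sublinear_scalar sm mmin.
pose f : {scalar V} := HB.pack m (GRing.isLinear.Build _ _ _ _ m lm).
exists f; rewrite {}/f.
have mp x : m x <= p x by exact: le_trans (qp x).
split=> //; apply/eqP; rewrite eq_le mp/=.
have := mq (- x0); have := sublinearN (- x0) sm; rewrite opprK; lra.
Qed.

End HahnBanach.

(** * Disjoint elements and a duality for common lower bounds *)

Section OrderedSpaces.
Context {R : realType} {V : lmodType R}.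
Implicit Types (P : set V) (x y z v w : V).

Lemma wedgeD P x y : is_wedge P -> P x -> P y -> P (x + y).
Proof.
move=> [_ wP] Px Py; rewrite -[x]scale1r -[y]scale1r.
by apply: wP; rewrite ?ler01.
Qed.

Lemma wedgeZ P (a : R) x : is_wedge P -> 0 <= a -> P x -> P (a *: x).
Proof.
move=> [_ wP] a0 Px; rewrite -[_ *: _]addr0 -(scale0r x).
by apply: wP.
Qed.

Lemma wedge0 P : is_wedge P -> P 0.
Proof. by move=> wP; have [[x Px] _] := wP; rewrite -(scale0r x); exact: wedgeZ. Qed.

Lemma cone_anti P x : is_cone P -> P x -> P (- x) -> x = 0.
Proof.
move=> [_ PN] Px PNx; suff : [set 0] x by [].
by rewrite -PN; split=> //; exists (- x); rewrite ?opprK.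
Qed.

Lemma is_coneI P : is_wedge P -> (forall x, P x -> P (- x) -> x = 0) -> is_cone P.
Proof.
move=> wP anti; split=> //; apply/seteqP; split=> [x [Px [y Py yx]]|x ->].
  by apply: anti => //; rewrite -yx opprK.
by split; [exact: wedge0|exists 0; [exact: wedge0|rewrite oppr0]].
Qed.

Definition disjoint_in P x y : Prop := [/\ P x, P y &
  forall w, cone_le P w x -> cone_le P w y -> cone_le P w 0].

(** Disjoint elements have infimum 0, so they are comparable, and the smaller
    one is a common lower bound, hence negative as well as positive. *)
Lemma anti_lattice_disjoint P x y :
  anti_lattice P -> disjoint_in P x y -> x = 0 \/ y = 0.
Proof.
move=> [cP _ _ infP] [Px Py xy].
have refl z : cone_le P z z by rewrite /cone_le subrr; exact: wedge0 cP.1.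
have : comparable_in P x y.
  by apply/infP; exists 0; split=> //; rewrite /cone_le subr0.
case=> [xley|ylex]; [left|right].
  by apply: (cone_anti cP) => //; rewrite -sub0r; exact: xy.
by apply: (cone_anti cP) => //; rewrite -sub0r; exact: xy.
Qed.

(** Subtracting an infimum z from x and y produces disjoint elements. *)
Lemma disjoint_anti_lattice P :
  is_cone P -> archimedean_cone P -> generating P ->
  (forall x y, disjoint_in P x y -> x = 0 \/ y = 0) -> anti_lattice P.
Proof.
move=> cP aP gP dP; split=> // x y; split=> [[z [zx zy zmax]]|].
  have [|/subr0_eq->|/subr0_eq->] := dP (x - z) (y - z); last by right.
    split=> // w; rewrite /cone_le -!addrA -!opprD => wx wy.
    by have := zmax _ wx wy; rewrite /cone_le opprD addNKr sub0r.
  by left.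
have refl z : cone_le P z z by rewrite /cone_le subrr; exact: wedge0 cP.1.
by case=> ?; [exists x|exists y]; split.
Qed.

(** The duality behind the Riesz-Kantorovich formula: the supremum of phi over
    the common lower bounds of s and t is the minimum of psi s + phi' t over
    the decompositions phi = psi + phi' into positive functionals.  The
    functional psi is a linear minorant, attaining at t - s, of the upper
    envelope of phi, that is z |-> inf of phi over the upper bounds v >= 0
    of z. *)
Lemma split_functional P (phi : {scalar V}) s t :
  is_wedge P -> generating P -> (forall v, P v -> 0 <= phi v) ->
  (forall r, cone_le P r s -> cone_le P r t -> phi r <= 0) ->
  exists psi : {scalar V}, (forall v, P v -> 0 <= psi v <= phi v) /\
    psi s + (phi t - psi t) <= 0.
Proof.
move=> wP gP phi0 st.
pose F z : set R := [set phi v | v in [set v | P v /\ P (v - z)]].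
have F0 z : F z !=set0.
  by have [a [b [Pa Pb ->]]] := gP z; exists (phi a), a; rewrite //= opprB addrC subrK.
have [] := @inf_sublinear R V F F0.
- move=> x y _ _ [v [Pv Pvx] <-] [w [Pw Pwy] <-]; exists (v + w); rewrite ?linearD//=.
  by rewrite addrACA; split; exact: wedgeD.
- move=> a x _ a0 [v [Pv Pvx] <-]; exists (a *: v); rewrite ?scalarZ//=.
  by rewrite -scalerBr; split; apply: wedgeZ => //; exact: ltW.
- by move=> _ [v [Pv _] <-]; exact: phi0.
move=> sF Fle; have [psi [psiF psits]] := hahn_banach (t - s) sF.
exists psi; split=> [v Pv|].
  apply/andP; split.
    rewrite -oppr_le0 -linearN (le_trans (psiF _))//= -(linear0 phi).
    by apply: Fle; exists 0; rewrite //= opprK add0r; split=> //; exact: wedge0.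
  apply: (le_trans (psiF v)); apply: Fle; exists v => //=.
  by rewrite subrr; split=> //; exact: wedge0.
have : phi t <= psi (t - s).
  rewrite psits /=; apply: lb_le_inf => // _ [v [Pv Pvts] <-].
  rewrite -subr_le0 -linearB; apply: st; rewrite /cone_le.
    by rewrite opprB addrCA -[s - t]opprB.
  by rewrite opprB addrC subrK.
by rewrite linearB; lra.
Qed.

End OrderedSpaces.

(** * Positive functionals and order units in normed spaces *)

Section PositiveFunctionals.
Context {R : realType} {X : normedModType R}.
Implicit Types (P : set X).

Lemma bounded_scalar (f : {scalar X}) (M : R) : (forall x, f x <= M * `|x|) ->
  exists g : bop X R^o, forall x, g x = f x.
Proof.
move=> fM; have bf : bounded_operator_pred (f : X -> R^o).
  apply/asboolP; split; first exact: linearP.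
  exists M => x; rewrite ler_norml fM andbT lerNl -linearN.
  by rewrite (le_trans (fM _))// normrN.
by exists (BOp bf).
Qed.

(** The sublinear functional is z |-> distance from z to - P: it vanishes on
    - P, dominated by the norm, and strictly positive at - y. *)
Lemma closed_wedge_separation P y : is_wedge P -> closed P -> ~ P y ->
  exists g : bop X R^o, dual_wedge P g /\ (g y : R) < 0.
Proof.
move=> wP cP Py.
pose F z : set R := [set r | exists2 q, P q & `|z + q| <= r].
have F0 z : F z !=set0 by exists `|z + 0|, 0 => //; exact: wedge0.
have [] := @inf_sublinear R X F F0.
- move=> x z r s [q Pq qr] [q' Pq' qs]; exists (q + q'); first exact: wedgeD.
  by rewrite addrACA (le_trans (ler_normD _ _))// lerD.
- move=> a x r a0 [q Pq qr]; exists (a *: q); first by apply: wedgeZ => //; exact: ltW.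
  by rewrite -scalerDr normrZ gtr0_norm// ler_pM2l.
- by move=> r [q _]; exact: le_trans.
move=> sF Fle; have [f [fF fy]] := hahn_banach (- y) sF.
have [|g gf] := @bounded_scalar f 1.
  move=> x; rewrite mul1r (le_trans (fF x))//; apply: Fle.
  by exists 0; rewrite ?addr0//; exact: wedge0.
exists g; split=> [x Px|]; rewrite gf.
  rewrite -oppr_le0 -linearN (le_trans (fF _))//; apply: Fle.
  by exists x; rewrite // addNr normr0.
have : open (~` P) by exact: closed_openC.
rewrite openE => /(_ y Py)/nbhs_ballP[d /= d0 yd].
rewrite -oppr_gt0 -linearN fy (lt_le_trans d0)//=; apply: lb_le_inf => // r [q Pq].
apply: le_trans; rewrite leNgt; apply/negP => qd.
by apply: (yd q) => //; rewrite -ball_normE /= -normrN opprB addrC.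
Qed.

(** Order unit in quantitative form: the order interval [- u, u] contains the
    unit ball. *)
Definition norm_unit P (u : X) : Prop := forall w, P (`|w| *: u - w).

Lemma norm_unit_generating P u : is_wedge P -> P u -> norm_unit P u -> generating P.
Proof.
move=> wP Pu uP z; exists (`|z| *: u), (`|z| *: u - z); split=> //.
  exact: wedgeZ.
by rewrite opprB addrC subrK.
Qed.

Lemma norm_unit_neq0 P u : is_cone P -> norm_unit P u ->
  (exists x : X, x != 0) -> u != 0.
Proof.
move=> cP uP [x x0]; apply/eqP => u0; move/eqP: x0; apply.
by apply: (cone_anti cP); [have := uP (- x)|have := uP x];
  rewrite u0 scaler0 sub0r ?opprK.
Qed.

Lemma interior_norm_unit P : is_wedge P -> interior P !=set0 ->
  exists u, P u /\ norm_unit P u.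
Proof.
move=> wP [y Py]; have Py' := interior_subset Py.
move/nbhs_ballP: Py => [d /= d0 yd].
exists ((2 / d) *: y); split; first by apply: wedgeZ => //; rewrite divr_ge0// ltW.
move=> w; have [->|w0] := eqVneq w 0.
  by rewrite normr0 scale0r subr0; exact: wedge0.
have nw : 0 < `|w| by rewrite normr_gt0.
have c0 : 0 < `|w| * (2 / d) by rewrite mulr_gt0// divr_gt0.
rewrite scalerA -{2}[w](scalerKV (negbT (gt_eqF c0))) -scalerBr.
apply: wedgeZ (ltW c0) _ => //; apply: yd; rewrite -ball_normE /=.
rewrite opprB addrC subrK normrZ normfV gtr0_norm//.
rewrite invfM invf_div mulrAC mulVf ?gt_eqF// mul1r ltr_pdivrMr// ltr_pMr//.
by rewrite ltr1n.
Qed.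

Lemma positive_le_norm P u (f : {scalar X}) : norm_unit P u ->
  (forall x, P x -> 0 <= f x) -> forall x, f x <= f u * `|x|.
Proof.
move=> uP f0 x; rewrite -subr_ge0; have := f0 _ (uP x).
by rewrite linearB linearZ mulrC.
Qed.

(** If x were not negative, a positive functional g would have g x > 0, and
    n g x <= g y for all n is impossible in the reals. *)
Lemma closed_archimedean P : is_wedge P -> closed P -> archimedean_cone P.
Proof.
move=> wP cP x y xy; rewrite /cone_le sub0r.
apply: contrapT => /(closed_wedge_separation wP cP)[g [gP gx]].
have gy n : (0 < n)%N -> n%:R * (g x : R) <= g y.
  move=> n0; have := gP _ (xy n n0); rewrite linearB linearZ /=.
  by rewrite subr_ge0.
have gx0 : 0 < (g x : R) by move: gx; rewrite linearN oppr_lt0.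
have := gy (Num.trunc ((g y : R) / g x)).+1 isT.
rewrite leNgt => /negP; apply; rewrite -ltr_pdivrMr//.
exact: truncnS_gt.
Qed.

(** Additivity of N on the cone makes z |-> inf over q in P of N (z + q) - N q
    a sublinear functional; its value at - x is at most - N x for x in P, so
    any linear minorant is at least N on P.  Rescaling turns N into the given
    norm. *)
Lemma additive_norm_functional P (N : X -> R) : is_wedge P ->
  equivalent_norm N -> additive_on P N ->
  exists e : bop X R^o, forall x, P x -> `|x| <= (e x : R).
Proof.
move=> wP [[ND NZ N0] [c [C [c0 C0 cC]]]] addN.
have N00 : N 0 = 0 by rewrite -(scale0r 0) NZ normr0 mul0r.
pose F z : set R := [set r | exists2 q, P q & N (z + q) - N q <= r].
have F0 z : F z !=set0 by exists (N (z + 0) - N 0), 0 => //; exact: wedge0.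
have [] := @inf_sublinear R X F F0.
- move=> x z r s [q Pq qr] [q' Pq' qs]; exists (q + q'); first exact: wedgeD.
  by rewrite (addN q)// addrACA; have := ND (x + q) (z + q'); lra.
- move=> a x r a0 [q Pq qr]; exists (a *: q); first by apply: wedgeZ => //; exact: ltW.
  by rewrite -scalerDr !NZ gtr0_norm// -mulrBr ler_pM2l.
- by move=> r [q _]; rewrite add0r subrr.
move=> sF Fle; have [f [fF _]] := hahn_banach 0 sF.
have [|g gf] := @bounded_scalar f C.
  move=> x; rewrite (le_trans (fF x))//; apply: Fle.
  exists 0; first exact: wedge0.
  by rewrite addr0 N00 subr0; case/andP: (cC x).
exists (c^-1 *: g) => x Px; rewrite -[(c^-1 *: g) x]/(c^-1 * (g x : R)) ler_pdivlMl//.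
case/andP: (cC x) => /le_trans + _; apply; rewrite gf -lerN2 -linearN.
rewrite (le_trans (fF _))//; apply: Fle; exists x => //.
by rewrite addNr N00 sub0r.
Qed.

End PositiveFunctionals.

(** * Bounded operators and operators of finite rank *)

Section BoundedLinear.
Context {R : realType} {X Y : normedModType R}.
Implicit Types (A : set X) (T : bop X Y).

Lemma closure_bop T A x (d : R) : closure A x -> 0 < d ->
  exists2 z, A z & `|T x - T z| < d.
Proof.
move=> Ax d0; have k0 : 0 < `|T| + 1 by rewrite ltr_wpDl.
have [z [Az]] := Ax _ (nbhsx_ballx x _ (divr_gt0 d0 k0)).
rewrite -ball_normE /= => zd; exists z => //.
rewrite -raddfB (le_lt_trans (bop_norm_bound _ _))//.
rewrite (@le_lt_trans _ _ ((`|T| + 1) * `|x - z|))//.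
  by rewrite ler_wpM2r// lerDl.
by rewrite mulrC -ltr_pdivlMr.
Qed.

Lemma bop_dense_eq0 T A : dense A -> (forall x, A x -> T x = 0) -> T = 0.
Proof.
move=> dA TA; apply: val_inj; apply/funext => x /=.
apply/eqP; rewrite -normr_le0 leNgt; apply/negP => Tx0.
have Ax : closure A x.
  move=> B; rewrite nbhsE; case=> O [oO Ox] OB.
  have [z [Oz Az]] := dA O (ex_intro _ x Ox) oO.
  by exists z; split=> //; exact: OB.
have [z Az] := closure_bop T Ax Tx0.
by rewrite (TA z)// subr0 ltxx.
Qed.

Lemma bop_total_eq0 T (P : set X) :
  total_cone P -> (forall x, P x -> T x = 0) -> T = 0.
Proof.
move=> tP TP; apply: (bop_dense_eq0 tP) => _ [n [c [v [Pv ->]]]].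
by rewrite linear_sum big1// => i _; rewrite linearZ/= TP// scaler0.
Qed.

End BoundedLinear.

Section Composition.
Context {R : realType} {X Y : normedModType R}.
Implicit Types (f : bop X R^o) (g : bop Y R^o) (y : Y).

Fact dual_comp_bounded g (T : bop X Y) :
  bounded_operator_pred (fun x => (g (T x) : R^o)).
Proof.
apply/asboolP; split; first by move=> a x z; rewrite !linearP.
exists (`|g| * `|T|) => x; rewrite (le_trans (bop_norm_bound _ _))//.
by rewrite -mulrA ler_wpM2l// bop_norm_bound.
Qed.

Definition dual_comp g T : bop X R^o := BOp (dual_comp_bounded g T).

Fact rank_one_bounded f y : bounded_operator_pred (fun x => (f x : R) *: y).
Proof.
apply/asboolP; split; first by move=> a x z; rewrite linearP scalerDl scalerA.
exists (`|f| * `|y|) => x; rewrite normrZ mulrAC ler_wpM2r//.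
exact: bop_norm_bound.
Qed.

Fact rank_one_approximable f y : approximable_pred (BOp (rank_one_bounded f y)).
Proof.
apply/asboolP; apply: subset_closure; exists [:: y] => _ [x _ <-].
exists 1%N, (fun=> (f x : R)), (fun=> y); split=> [i /=|]; first by rewrite inE.
by rewrite big_ord1.
Qed.

Definition rank_one f y : approx_op X Y := ApproxOp (rank_one_approximable f y).

Lemma approx_opP (S T : approx_op X Y) : (forall x, S x = T x) -> S = T.
Proof. by move=> ST; do 2!apply: val_inj; apply/funext. Qed.

Lemma rank_one_linearl y (a : R) f h :
  rank_one (a *: f + h) y = a *: rank_one f y + rank_one h y.
Proof.
apply: approx_opP => x.
rewrite -[LHS]/((a * (f x : R) + (h x : R)) *: y).
by rewrite -[RHS]/(a *: ((f x : R) *: y) + (h x : R) *: y) scalerA scalerDl.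
Qed.

Lemma rank_one_linearr f (a : R) y z :
  rank_one f (a *: y + z) = a *: rank_one f y + rank_one f z.
Proof.
apply: approx_opP => x.
rewrite -[LHS]/((f x : R) *: (a *: y + z)).
rewrite -[RHS]/(a *: ((f x : R) *: y) + (f x : R) *: z).
by rewrite scalerDr !scalerA mulrC.
Qed.

Fact eval_at_scalar (x : X) g :
  scalar (fun T : approx_op X Y => (g (T x) : R)).
Proof. by move=> a S T; rewrite -linearP. Qed.

Definition eval_at x g : {scalar approx_op X Y} :=
  HB.pack (fun T : approx_op X Y => (g (T x) : R))
    (GRing.isLinear.Build _ _ _ _ _ (eval_at_scalar x g)).

End Composition.

Section FiniteRank.
Context {R : realType} {X Y : normedModType R}.

Lemma linear_span_cons (y : Y) (s : seq Y) z : linear_span [set` y :: s] z ->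
  exists (c : R) w, linear_span [set` s] w /\ z = c *: y + w.
Proof.
move=> [n [c [v [sv ->]]]].
pose D z := exists (c : R) w, linear_span [set` s] w /\ z = c *: y + w.
apply: (big_ind D) => [|_ _ [a [w [sw ->]]] [b [w' [sw' ->]]]|i _].
- by exists 0, 0; rewrite scale0r addr0; split=> //; exact: linear_span0.
- exists (a + b), (w + w'); rewrite scalerDl addrACA; split=> //.
  by rewrite -[w]scale1r; exact: linear_span_lin.
have /= := sv i; rewrite inE => /predU1P[->|si].
  by exists (c i), 0; rewrite addr0; split=> //; exact: linear_span0.
exists 0, (c i *: v i); rewrite scale0r add0r; split=> //.
by exists 1%N, (fun=> c i), (fun=> v i); rewrite big_ord1.
Qed.

Lemma linear_span_consI (y : Y) (s : seq Y) (c : R) w :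
  linear_span [set` s] w -> linear_span [set` y :: s] (c *: y + w).
Proof.
move=> sw; apply: linear_span_lin.
  exists 1%N, (fun=> 1), (fun=> y); rewrite big_ord1 scale1r; split=> // i /=.
  exact: mem_head.
apply: sub_linear_span sw => z /=; rewrite inE => ->; exact: orbT.
Qed.

(** Finite-dimensional subspaces are separated from points outside by continuous
    functionals.  Induction on s: with g vanishing on the tail and g a = 1, the
    functional z |-> h (z - g z a), for h separating y - g y a from the tail,
    also vanishes at a. *)
Lemma span_separation (s : seq Y) y : ~ linear_span [set` s] y ->
  exists g : bop Y R^o, (forall z, linear_span [set` s] z -> g z = 0) /\ g y = 1.
Proof.
elim: s y => [|a s IHs] y sy.
  have y0 : ~ [set 0] (- y).
    move=> /eqP; rewrite oppr_eq0 => /eqP y0; apply: sy; rewrite y0.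
    exact: linear_span0.
  have w0 : is_wedge [set (0 : Y)].
    by split=> [|b c _ _ _ _ -> ->]; [exists 0|rewrite !scaler0 addr0].
  have [|g [_ gy]] := closed_wedge_separation w0 _ y0.
    by apply: accessible_closed_set1; apply: hausdorff_accessible; exact: norm_hausdorff.
  have gy0 : (g y : R) != 0 by move: gy; rewrite linearN oppr_lt0; exact: lt0r_neq0.
  exists ((g y : R)^-1 *: g); split; last by exact: mulVf.
  by move=> _ [n [c [v [sv ->]]]]; rewrite linear_sum big1// => i; have := sv i.
have [sa|sa] := pselect (linear_span [set` s] a).
  have {}sy : ~ linear_span [set` s] y.
    by move=> ?; apply: sy; rewrite -[y]add0r -(scale0r a); exact: linear_span_consI.
  have [g [gs gy]] := IHs _ sy; exists g; split=> //.
  by move=> z /linear_span_cons[c [w [sw ->]]]; rewrite linearP/= !gs// scaler0 addr0.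
have [g [gs ga]] := IHs _ sa.
have sya : ~ linear_span [set` s] (y - (g y : R) *: a).
  move=> /(@linear_span_consI a _ (g y)); rewrite addrC subrK; exact: sy.
have [h [hs hy]] := IHs _ sya.
exists (h - (h a : R) *: g); split.
  move=> z /linear_span_cons[c [w [sw ->]]].
  rewrite -[LHS]/((h (c *: a + w) : R) - (h a : R) * (g (c *: a + w) : R)).
  rewrite !linearP/= (gs w)// (hs w)// ga -[_ *: 1]/(c * 1) -[c *: h a]/(c * (h a : R)).
  by ring.
move: hy; rewrite linearB linearZ /= => <-.
rewrite -[LHS]/((h y : R) - (h a : R) * (g y : R)).
by rewrite mulrC.
Qed.

(** An operator of finite rank is a sum of rank one operators with continuous
    coefficients: peel off one spanning vector y at a time by subtracting
    (g o T) (x) y, for a functional g that kills the other vectors and has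
    g y = 1. *)
Lemma eq_rank_one_finite_rank (F G : {scalar approx_op X Y}) :
  (forall f y, F (rank_one f y) = G (rank_one f y)) ->
  forall T : approx_op X Y, finite_rank T -> F T = G T.
Proof.
move=> FG T [s]; elim: s T => [|y s IHs] T sT.
  suff -> : T = 0 by rewrite !linear0.
  apply: approx_opP => x; have [|n [c [v [sv ->]]]] := sT (T x); first by exists x.
  by rewrite big1// => i; have := sv i.
have [sy|sy] := pselect (linear_span [set` s] y).
  apply: IHs => z /sT /linear_span_cons[c [w [sw ->]]].
  exact: linear_span_lin.
have [g [gs gy]] := span_separation sy.
pose T1 := rank_one (dual_comp g T) y.
rewrite -[T](subrK T1) (linearD F) (linearD G) FG; congr (_ + _).
apply: IHs => _ [x _ <-].
rewrite -[(T - T1) x]/(T x - (g (T x) : R) *: y).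
have [|c [w [sw ->]]] := @linear_span_cons y s (T x); first by apply: sT; exists x.
by rewrite linearP/= (gs w)// gy addr0 -[c *: 1]/(c * 1) mulr1 addrC addKr.
Qed.

End FiniteRank.

(** * Cones of operators *)

Section OperatorConeTheory.
Context {R : realType} {X Y : normedModType R} {P : set X} {Q : set Y}.

Lemma bop_cone_is_cone : total_cone P -> is_cone Q -> is_cone (bop_cone P Q).
Proof.
move=> tP cQ; apply: is_coneI.
  split=> [|a b S T a0 b0 SP TP x Px].
    by exists 0 => x _; exact: wedge0 cQ.1.
  apply: wedgeD cQ.1 _ _; apply: wedgeZ cQ.1 _ _ => //; [exact: SP|exact: TP].
move=> T TP NTP; apply: (bop_total_eq0 tP) => x Px.
by apply: (cone_anti cQ); [exact: TP|exact: NTP].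
Qed.

Lemma bop_cone_archimedean :
  archimedean_cone Q -> archimedean_cone (bop_cone P Q).
Proof.
move=> aQ S T ST x Px; rewrite -[(0 - S) x]/(0 - S x); apply: (aQ _ (T x)) => n n0.
have := ST n n0 x Px.
by rewrite -[(T - n%:R *: S) x]/(T x - n%:R *: S x).
Qed.

Lemma approx_op_cone_is_cone :
  total_cone P -> is_cone Q -> is_cone (approx_op_cone P Q).
Proof.
move=> tP cQ; have [[_ wC] _] := bop_cone_is_cone tP cQ; apply: is_coneI.
  split=> [|a b S T a0 b0 SP TP]; last exact: wC.
  by exists 0 => x _; exact: wedge0 cQ.1.
move=> T TP NTP; apply: val_inj; apply: (bop_total_eq0 tP) => x Px.
by apply: (cone_anti cQ); [exact: TP|exact: NTP].
Qed.

Lemma approx_op_cone_archimedean :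
  archimedean_cone Q -> archimedean_cone (approx_op_cone P Q).
Proof. by move=> aQ S T; exact: (bop_cone_archimedean aQ). Qed.

Lemma nonneg_is_cone : is_cone [set r : R^o | 0 <= (r : R)].
Proof.
apply: is_coneI => [|r /= r0 Nr0].
  split=> [|a b r s a0 b0 /= r0 s0]; first by exists 0 => /=.
  by rewrite addr_ge0// mulr_ge0.
by apply/eqP; rewrite eq_le r0 andbT -oppr_ge0.
Qed.

Lemma nonneg_archimedean : archimedean_cone [set r : R^o | 0 <= (r : R)].
Proof. apply: closed_archimedean nonneg_is_cone.1 _; exact: closed_ge. Qed.

End OperatorConeTheory.

Lemma dual_wedge_is_cone (R : realType) (X : normedModType R) (P : set X) :
  total_cone P -> is_cone (dual_wedge P).
Proof. move=> tP; exact: (bop_cone_is_cone tP nonneg_is_cone). Qed.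

Lemma dual_wedge_archimedean (R : realType) (X : normedModType R) (P : set X) :
  archimedean_cone (dual_wedge P).
Proof. exact: (bop_cone_archimedean nonneg_archimedean). Qed.

Lemma dual_wedge_le (R : realType) (X : normedModType R) (P : set X)
  (f : bop X R^o) x y : dual_wedge P f -> cone_le P x y -> (f x : R) <= f y.
Proof. by move=> fP /fP; rewrite linearB subr_ge0. Qed.

Section AdditiveNormCone.
Context {R : realType} {X Y : normedModType R} {P : set X} {Q : set Y}.
Variables (e : bop X R^o) (u : Y).
Hypotheses (eP : forall x, P x -> `|x| <= (e x : R)) (wQ : is_wedge Q)
  (Qu : Q u) (uQ : norm_unit Q u).

Lemma dual_unit_ge0 : dual_wedge P e.
Proof. by move=> x Px; exact: le_trans (eP Px). Qed.

Lemma dual_norm_unit : norm_unit (dual_wedge P) e.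
Proof.
move=> f x Px.
have evalE (a : R) : (a *: e - f) x = a * (e x : R) - (f x : R) :> R by [].
rewrite evalE subr_ge0.
rewrite (le_trans (ler_norm _))// (le_trans (bop_norm_bound _ _))//.
by rewrite ler_wpM2l// eP.
Qed.

Lemma rank_one_ge0 f y : dual_wedge P f -> Q y ->
  approx_op_cone P Q (rank_one f y).
Proof. by move=> fP Qy x Px; apply: wedgeZ => //; exact: fP. Qed.

(** T x <= |T x| u <= |T| |x| u <= |T| e x u on the cone, so rank_one e u is an
    order unit that controls the operator norm. *)
Lemma approx_op_le_unit (T : approx_op X Y) :
  approx_op_cone P Q (`|approx_op_val T| *: rank_one e u - T).
Proof.
move=> x Px; set t := `|approx_op_val T|.
rewrite -[(t *: rank_one e u - T) x]/(t *: ((e x : R) *: u) - T x) scalerA.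
rewrite -[_ *: u](subrK (`|T x| *: u)) -scalerBl -addrA.
apply: wedgeD => //.
apply: wedgeZ => //; rewrite subr_ge0 (le_trans (bop_norm_bound _ _))//.
by rewrite ler_wpM2l// eP.
Qed.

Lemma approx_op_cone_generating : is_wedge (approx_op_cone P Q) ->
  generating (approx_op_cone P Q).
Proof.
move=> wC T; pose E := `|approx_op_val T| *: rank_one e u.
exists E, (E - T); split; last by rewrite opprB addrC subrK.
  by apply: (wedgeZ wC) => //; apply: rank_one_ge0 => //; exact: dual_unit_ge0.
exact: approx_op_le_unit.
Qed.

Lemma positive_le_op_norm (F : {scalar approx_op X Y}) :
  (forall T, approx_op_cone P Q T -> 0 <= F T) ->
  forall T, F T <= F (rank_one e u) * `|approx_op_val T|.
Proof.
move=> F0 T; have := F0 _ (approx_op_le_unit T).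
by rewrite linearB scalarZ subr_ge0 mulrC.
Qed.

(** Positive functionals are bounded by the operator norm, thanks to the order
    unit, and operators of finite rank are dense. *)
Lemma positive_eq_rank_one (F G : {scalar approx_op X Y}) :
  (forall T, approx_op_cone P Q T -> 0 <= F T) ->
  (forall T, approx_op_cone P Q T -> 0 <= G T) ->
  (forall f y, F (rank_one f y) = G (rank_one f y)) ->
  forall T, F T = G T.
Proof.
move=> F0 G0 FG.
have FGfin := eq_rank_one_finite_rank FG.
have le (F' G' : {scalar approx_op X Y}) :
    (forall T, approx_op_cone P Q T -> 0 <= F' T) ->
    (forall T, approx_op_cone P Q T -> 0 <= G' T) ->
    (forall T : approx_op X Y, finite_rank T -> F' T = G' T) ->
    forall T, F' T <= G' T.
  move=> F0' G0' FG' T; apply/ler_addgt0Pr => d d0.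
  pose K := F' (rank_one e u) + G' (rank_one e u).
  have K0 : 0 <= K.
    by rewrite addr_ge0// ?F0' ?G0'//; apply: rank_one_ge0 => //; exact: dual_unit_ge0.
  have K1 : 0 < K + 1 by rewrite ltr_wpDl.
  have /asboolP clT := approx_op_in T.
  have [S [Sfin]] := clT _ (nbhsx_ballx (approx_op_val T) _ (divr_gt0 d0 K1)).
  rewrite -ball_normE /= => ST.
  have Sin : approximable_pred S.
    by apply/asboolP; apply: subset_closure.
  pose S' := ApproxOp Sin.
  have := FG' S' Sfin.
  have := positive_le_op_norm F0' (T - S').
  have := positive_le_op_norm G0' (S' - T).
  have -> : `|approx_op_val (S' - T)| = `|approx_op_val T - S| by rewrite distrC.
  have -> : `|approx_op_val (T - S')| = `|approx_op_val T - S| by [].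
  rewrite !linearB.
  have : K * `|approx_op_val T - S| <= d.
    rewrite (@le_trans _ _ ((K + 1) * `|approx_op_val T - S|))//.
      by rewrite ler_wpM2r// lerDl.
    by rewrite mulrC -ler_pdivlMr// ltW.
  by rewrite mulrDl; lra.
by move=> T; apply/eqP; rewrite eq_le !le// => S Sfin; rewrite FGfin.
Qed.

(** The functional A |-> g (A x) has no positive minorants other than the
    A |-> d (A x) with 0 <= d <= g: for fixed y >= 0, the
    map f |-> F (f (x) y) is an element of the bidual lying between 0 and
    g y times x, hence a multiple of x by extremality.  The multiplier is
    additive in y, which gives d; the formula propagates from rank one operators
    to all approximable ones. *)
Lemma extremal_factor (x : X) (g : bop Y R^o) (F : {scalar approx_op X Y}) :
  P x -> x != 0 -> dual_wedge Q g ->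
  extremal (dual_wedge (dual_wedge P)) (canonical_embedding x) ->
  (forall T, approx_op_cone P Q T -> 0 <= F T <= eval_at x g T) ->
  exists d : bop Y R^o, [/\ dual_wedge Q d, dual_wedge Q (g - d) &
    forall T, F T = (d (T x) : R)].
Proof.
move=> Px x0 gQ xext FP.
have ex0 : 0 < (e x : R) by rewrite (lt_le_trans _ (eP Px))// normr_gt0.
have F0 T : approx_op_cone P Q T -> 0 <= F T by move=> /FP/andP[].
have factor y : Q y -> exists c : R, forall f, F (rank_one f y) = c * (f x : R).
  move=> Qy; have lk : scalar (fun f : bop X R^o => F (rank_one f y)).
    by move=> a f h; rewrite rank_one_linearl linearP.
  pose k : {scalar bop X R^o} := HB.pack (fun f : bop X R^o => F (rank_one f y))
    (GRing.isLinear.Build _ _ _ _ _ lk).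
  have k0 f : dual_wedge P f -> 0 <= k f.
    by move=> fP; apply: F0; exact: rank_one_ge0.
  have [K kK] := bounded_scalar (positive_le_norm dual_norm_unit k0).
  (* Scaling K by g y + 1 rather than g y covers the case g y = 0 as well. *)
  pose a := (g y : R) + 1.
  have a0 : 0 < a by rewrite ltr_wpDl// gQ.
  have KE f : (a^-1 *: K) f = a^-1 * F (rank_one f y) :> R.
    by rewrite -[LHS]/(a^-1 * (K f : R)) kK.
  have [|c Kc] := xext.2 (a^-1 *: K).
    split; rewrite /cone_le => f fP.
      by rewrite subr0 KE mulr_ge0 ?invr_ge0 ?(ltW a0)// F0//; exact: rank_one_ge0.
    rewrite -[_ f]/((f x : R) - ((a^-1 *: K) f : R)) KE subr_ge0 ler_pdivrMl//.
    have /andP[_ /le_trans] := FP _ (rank_one_ge0 fP Qy); apply.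
    rewrite -[leLHS]/((g ((f x : R) *: y)) : R) linearZ -[leLHS]/((f x : R) * (g y : R)).
    by rewrite mulrC /a mulrDl mul1r lerDl; exact: xext.1.
  exists (a * c) => f.
  rewrite -[LHS](mulVKf (negbT (gt_eqF a0))) -KE Kc -mulrA.
  by [].
have ld : scalar (fun y => (e x : R)^-1 * F (rank_one e y)).
  by move=> a y z; rewrite rank_one_linearr linearP mulrDr mulrCA.
pose d : {scalar Y} := HB.pack (fun y => (e x : R)^-1 * F (rank_one e y))
  (GRing.isLinear.Build _ _ _ _ _ ld).
have d0 y : Q y -> 0 <= d y.
  move=> Qy; rewrite mulr_ge0 ?invr_ge0 ?(ltW ex0)// F0//.
  by apply: rank_one_ge0 => //; exact: dual_unit_ge0.
have [D Dd] := bounded_scalar (positive_le_norm uQ d0).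
have FD f y : F (rank_one f y) = (f x : R) * (D y : R).
  have FDQ z : Q z -> F (rank_one f z) = (f x : R) * (D z : R).
    move=> Qz; have [c Fc] := factor z Qz; rewrite Dd [d z]/= !Fc.
    by rewrite [_^-1 * _]mulrCA mulVf ?mulr1 ?gt_eqF// mulrC.
  have [v [w [Qv Qw ->]]] := norm_unit_generating wQ Qu uQ y.
  have -> : rank_one f (v - w) = rank_one f v - rank_one f w.
    by rewrite -[v - w]addrC -scaleN1r rank_one_linearr scaleN1r addrC.
  by rewrite linearB (linearB D) !FDQ// mulrBr.
have DQ : dual_wedge Q D by move=> y Qy; rewrite Dd; exact: d0.
exists D; split=> // [y Qy|].
  rewrite -[(g - D) y]/((g y : R) - (D y : R)) subr_ge0 Dd [d y]/= ler_pdivrMl//.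
  have /andP[_] := FP _ (rank_one_ge0 dual_unit_ge0 Qy).
  rewrite -[eval_at x g _]/(g ((e x : R) *: y) : R) linearZ.
  exact.
apply: (@positive_eq_rank_one F (eval_at x D)) => [//|T TP|f y].
  by apply: DQ; exact: TP.
rewrite FD -[RHS]/(D ((f x : R) *: y) : R) linearZ.
by [].
Qed.

End AdditiveNormCone.

(** * Transfer of disjointness between operators, X' and Y *)

Section AntiLattices.
Context {R : realType} {X Y : normedModType R} {P : set X} {Q : set Y}.
Variables (e : bop X R^o) (u : Y).
Hypotheses (eP : forall x, P x -> `|x| <= (e x : R)) (Qu : Q u)
  (uQ : norm_unit Q u) (tP : total_cone P) (cQ : is_cone Q) (clQ : closed Q).

Let wQ : is_wedge Q := cQ.1.
Let wC : is_wedge (approx_op_cone P Q) := (approx_op_cone_is_cone tP cQ).1.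

(** A common lower bound T that is not negative yields x in P and a positive g
    with g (T x) > 0; then g u > 0 and the functional (g o T) / g u is a common
    lower bound of f and h that is positive at x. *)
Lemma disjoint_rank_one_dual f h : disjoint_in (dual_wedge P) f h ->
  disjoint_in (approx_op_cone P Q) (rank_one f u) (rank_one h u).
Proof.
move=> [fP hP fh]; split; [exact: rank_one_ge0|exact: rank_one_ge0|].
move=> T Tf Th x Px; apply: contrapT => /(closed_wedge_separation wQ clQ)[g [gQ gT]].
have gTx : 0 < (g (T x) : R).
  by move: gT; rewrite -[(0 - T) x]/(0 - T x) sub0r linearN oppr_lt0.
have below k : cone_le (approx_op_cone P Q) T (rank_one k u) ->
    forall z, P z -> (g (T z) : R) <= (k z : R) * (g u : R).
  move=> Tk z Pz; have := gQ _ (Tk z Pz).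
  rewrite -[(rank_one k u - T) z]/((k z : R) *: u - T z) linearB linearZ.
  by rewrite subr_ge0.
have gu0 : 0 < (g u : R).
  rewrite lt_neqAle gQ// andbT eq_sym; apply/negP => /eqP gu.
  by have := below _ Tf x Px; rewrite gu mulr0 leNgt gTx.
pose k := (g u : R)^-1 *: dual_comp g T.
have kE z : k z = (g u : R)^-1 * (g (T z) : R) :> R by [].
have kle h' : cone_le (approx_op_cone P Q) T (rank_one h' u) ->
    cone_le (dual_wedge P) k h'.
  move=> Th' z Pz; rewrite -[_ z]/((h' z : R) - (k z : R)) subr_ge0 kE.
  by rewrite ler_pdivrMl// mulrC below.
have := fh k (kle _ Tf) (kle _ Th) x Px.
rewrite -[_ x]/(0 - (k x : R)) sub0r oppr_ge0 kE pmulr_rle0 ?invr_gt0//.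
by rewrite leNgt gTx.
Qed.

(** A common lower bound T satisfies T x / e x <= y and T x / e x <= z at each
    non-zero x in P. *)
Lemma disjoint_rank_one_codomain y z : disjoint_in Q y z ->
  disjoint_in (approx_op_cone P Q) (rank_one e y) (rank_one e z).
Proof.
have e0 := dual_unit_ge0 eP.
move=> [Qy Qz yz]; split; [exact: rank_one_ge0|exact: rank_one_ge0|].
move=> T Ty Tz x Px; have [->|x0] := eqVneq x 0; first by rewrite linear0; exact: wedge0.
have ex0 : 0 < (e x : R) by rewrite (lt_le_trans _ (eP Px))// normr_gt0.
have scaled w : cone_le (approx_op_cone P Q) T (rank_one e w) ->
    cone_le Q ((e x : R)^-1 *: T x) w.
  move=> /(_ x Px); rewrite -[_ x]/((e x : R) *: w - T x) => Qw.
  rewrite /cone_le -[w](scalerK (negbT (gt_eqF ex0))) -scalerBr.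
  by apply: wedgeZ => //; rewrite invr_ge0 ltW.
have := wedgeZ wQ (ltW ex0) (yz _ (scaled _ Ty) (scaled _ Tz)).
by rewrite scalerBr scaler0 scalerKV// gt_eqF.
Qed.

(** Extremality of x in the bidual cone is what lets common lower bounds of S x
    and T x be compared with those of S and T. *)
Lemma disjoint_at_extremal (S T : approx_op X Y) x :
  disjoint_in (approx_op_cone P Q) S T -> P x ->
  extremal (dual_wedge (dual_wedge P)) (canonical_embedding x) ->
  disjoint_in Q (S x) (T x).
Proof.
move=> [S0 T0 ST] Px xext; split; [exact: S0|exact: T0|].
have [->|x0] := eqVneq x 0; first by move=> z; rewrite linear0.
move=> z zS zT; apply: contrapT => /(closed_wedge_separation wQ clQ)[g [gQ gz]].
have gz0 : 0 < (g z : R) by move: gz; rewrite sub0r linearN oppr_lt0.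
have [||F [FP FST]] := split_functional wC
    (approx_op_cone_generating eP wQ Qu uQ wC) (phi := eval_at x g) (s := S) (t := T).
- by move=> A AP; apply: gQ; exact: AP.
- move=> A AS AT; have := gQ _ (ST A AS AT x Px).
  by rewrite -[_ x]/(0 - A x) sub0r linearN oppr_ge0.
have [d [dQ gdQ Fd]] := extremal_factor eP wQ Qu uQ Px x0 gQ xext FP.
have dz := dual_wedge_le dQ zS.
have gdz : (g z : R) - (d z : R) <= (g (T x) : R) - (d (T x) : R).
  exact: (dual_wedge_le gdQ zT).
move: FST; rewrite !Fd -[eval_at x g T]/(g (T x) : R); lra.
Qed.

(** A common lower bound is negative at every extremal vector, where one of
    the two functionals vanishes, and these vectors determine its sign on P by
    convexity and density. *)
Lemma dual_comp_disjoint (S T : approx_op X Y) (g : bop Y R^o) :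
  P `<=` closure (convex_hull (extremal P)) ->
  (forall x, extremal P x -> S x = 0 \/ T x = 0) ->
  approx_op_cone P Q S -> approx_op_cone P Q T -> dual_wedge Q g ->
  disjoint_in (dual_wedge P) (dual_comp g S) (dual_comp g T).
Proof.
move=> hull ST S0 T0 gQ; split => [x Px|x Px|k kS kT x Px].
- by apply: gQ; exact: S0.
- by apply: gQ; exact: T0.
have kext v : extremal P v -> (k v : R) <= 0.
  move=> vext; have Pv := vext.1.
  have := kS v Pv; have := kT v Pv.
  rewrite -[_ v]/((g (T v) : R) - (k v : R)) => kTv.
  rewrite -[_ v]/((g (S v) : R) - (k v : R)) => kSv; move: kTv kSv.
  by have [->|->] := ST v vext; rewrite linear0; lra.
have khull v : convex_hull (extremal P) v -> (k v : R) <= 0.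
  move=> [n [c [w [c0 _ wext ->]]]]; rewrite linear_sum sumr_le0// => i _.
  by rewrite linearZ mulr_ge0_le0// kext.
rewrite -[_ x]/(0 - (k x : R)) sub0r oppr_ge0 leNgt; apply/negP => kx.
have [v /khull kv] := closure_bop k (hull _ Px) kx.
rewrite ltr_norml => /andP[_]; move: kv; lra.
Qed.

Lemma rank_one_eq0 (f : bop X R^o) (y : Y) : rank_one f y = 0 -> f = 0 \/ y = 0.
Proof.
move=> fy; have [->|y0] := eqVneq y 0; [by right|left].
apply: val_inj; apply/funext => x /=; apply/eqP.
have /eqP : (f x : R) *: y = 0 by rewrite -[LHS]/(rank_one f y x) fy.
by rewrite scaler_eq0 (negPf y0) orbF.
Qed.

(** * Anti-lattices of operators *)

Lemma anti_lattice_dual : u != 0 ->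
  anti_lattice (approx_op_cone P Q) -> anti_lattice (dual_wedge P).
Proof.
move=> u0 aC; have cD := dual_wedge_is_cone tP; apply: disjoint_anti_lattice => //.
- exact: dual_wedge_archimedean.
- exact: norm_unit_generating cD.1 (dual_unit_ge0 eP) (dual_norm_unit eP).
move=> f h /disjoint_rank_one_dual/(anti_lattice_disjoint aC).
have neq (k : bop X R^o) : rank_one k u = 0 -> k = 0.
  by move=> /rank_one_eq0[//|uE]; rewrite uE eqxx in u0.
by case=> /neq; [left|right].
Qed.

Lemma anti_lattice_codomain : (exists x : X, x != 0) ->
  anti_lattice (approx_op_cone P Q) -> anti_lattice Q.
Proof.
move=> [x x0] aC; apply: disjoint_anti_lattice => //.
- exact: closed_archimedean.
- exact: norm_unit_generating Qu uQ.
(* Were e = 0, the cone P would be trivial and, being total, X too. *)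
have e0 : e <> 0.
  move=> e0; have bid : bounded_operator_pred (fun z : X => z).
    by apply/asboolP; split=> [//|]; exists 1 => z; rewrite mul1r.
  have id0 : BOp bid = 0.
    apply: (bop_total_eq0 tP) => z /eP; rewrite e0 => /= z0.
    by apply/eqP; rewrite -normr_le0.
  have : BOp bid x = 0 by rewrite id0.
  by move=> /eqP; apply/negP.
move=> y z /disjoint_rank_one_codomain/(anti_lattice_disjoint aC).
by case=> /rank_one_eq0[//|->]; [left|right].
Qed.

(** Dichotomies propagate from points to functionals and from functionals to
    operators: at each extremal vector S or T vanishes because Q is an
    anti-lattice, after each positive g because the dual is one, and the last
    step tests g + h for g detecting S and h detecting T. *)
Lemma anti_lattice_operators :
  P `<=` closure (convex_hull (extremal P)) ->
  (forall x, extremal P x ->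
    extremal (dual_wedge (dual_wedge P)) (canonical_embedding x)) ->
  anti_lattice (dual_wedge P) -> anti_lattice Q ->
  anti_lattice (approx_op_cone P Q).
Proof.
move=> hull ext aD aQ; have cC := approx_op_cone_is_cone tP cQ.
apply: disjoint_anti_lattice => //.
- apply: approx_op_cone_archimedean; exact: closed_archimedean.
- exact: approx_op_cone_generating eP wQ Qu uQ wC.
move=> S T ST; have [S0 T0 _] := ST.
have STx x : extremal P x -> S x = 0 \/ T x = 0.
  move=> xext; apply: (anti_lattice_disjoint aQ).
  exact: (disjoint_at_extremal ST xext.1 (ext x xext)).
have gST g (gQ : dual_wedge Q g) :=
  anti_lattice_disjoint aD (dual_comp_disjoint hull STx S0 T0 gQ).
have detect (A : approx_op X Y) : approx_op_cone P Q A -> A <> 0 ->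
    exists x g, [/\ P x, dual_wedge Q g & 0 < (g (A x) : R)].
  move=> A0 Aneq0; have [x [Px Ax0]] : exists x, P x /\ A x <> 0.
    apply: contrapT => noP; apply: Aneq0; apply: val_inj.
    apply: (bop_total_eq0 tP) => x Px.
    by apply: contrapT => Ax; apply: noP; exists x.
  have QNAx : ~ Q (- A x) by move=> /(cone_anti cQ (A0 _ Px)).
  have [g [gQ gAx]] := closed_wedge_separation wQ clQ QNAx.
  by exists x, g; split=> //; rewrite -oppr_lt0 -linearN.
apply: contrapT => /not_orP[/(detect S S0)[x [g [Px gQ gSx]]]].
move=> /(detect T T0)[z [h [Pz hQ hTz]]].
have ghQ : dual_wedge Q (g + h).
  by move=> y Qy; rewrite -[_ y]/((g y : R) + (h y : R)) addr_ge0// ?gQ ?hQ.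
case: (gST _ ghQ) => /(congr1 (fun k : bop X R^o => (k : X -> R))).
  move=> /(congr1 (@^~ x)).
  rewrite -[LHS]/((g (S x) : R) + (h (S x) : R)) => /eqP; apply/negP.
  by rewrite gt_eqF// ltr_wpDr// hQ//; exact: S0.
move=> /(congr1 (@^~ z)).
rewrite -[LHS]/((g (T z) : R) + (h (T z) : R)) => /eqP; apply/negP.
by rewrite gt_eqF// ltr_wpDl// gQ//; exact: T0.
Qed.

End AntiLattices.

Theorem corollary6p6 (R : realType) (X Y : normedModType R)
  (Xp : set X) (Yp : set Y)
  (X_ordered : ordered_normed_space Xp) (Y_ordered : ordered_normed_space Yp)
  (X_nonzero : exists x : X, x != 0) (Y_nonzero : exists y : Y, y != 0)
  (Xp_total : total_cone Xp)
  (Xp_additive_norm : exists N : X -> R, equivalent_norm N /\ additive_on Xp N)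
  (Xp_extremal_bidual : forall x : X, extremal Xp x ->
    extremal (dual_wedge (dual_wedge Xp)) (canonical_embedding x))
  (Xp_extremal_dense : Xp `<=` closure (convex_hull (extremal Xp)))
  (Yp_interior : interior Yp !=set0) :
  anti_lattice (approx_op_cone Xp Yp) <->
  anti_lattice (dual_wedge Xp) /\ anti_lattice Yp.
Proof.
have [[wX _] _] := X_ordered; have [cY clY] := Y_ordered.
have [N [eqN addN]] := Xp_additive_norm.
have [e eP] := additive_norm_functional wX eqN addN.
have [u [Yu uY]] := interior_norm_unit cY.1 Yp_interior.
have u0 := norm_unit_neq0 cY uY Y_nonzero.
split=> [aC|[aD aY]]; last exact: (anti_lattice_operators eP Yu uY).
split; first exact: (anti_lattice_dual eP Yu).
exact: (anti_lattice_codomain eP Yu uY).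
Qed.
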